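(* Let $n\ge 2$, $d\ge1$, $r\ge3$ with $n\ge d$, $dr\equiv0\pmod n$ and $dr\ge 2n$. For every vertex $(a,x)$ of $Q_n(d,r)$ with $0\le x\le\lfloor r/2\rfloor$, $$\mathrm{dist}((0_n,0),(a,x))=\|a\|+2\lceil n/d\rceil-x-2\,\mathrm{leap}_1(a,x).$$
   Context: $\mathbb{Z}_2^n=\{0,1\}^n$ with coordinatewise addition mod 2; $e_i$ is the $i$-th standard basis vector, subscripts read modulo $n$; $\|a\|$ is the Hamming weight. The recursive cube of rings $Q_n(d,r)$ is the simple graph on $\mathbb{Z}_2^n\times\mathbb{Z}_r$ in which $(a,x)$ is adjacent to $(a+e_{i+dx},x)$ for $1\le i\le d$ and to $(a,x\pm1)$. Definition of $\mathrm{leap}_1$ (case $dr\ge 2n$): let $q=\lceil n/d\rceil$, $s=\|a\|$, and let $i_1<i_2<\dots<i_s$ be the indices with $a_i=1$. Put $y_0=0$, and for $1\le t\le s$ put $y_t=\lfloor (i_t-1)/d\rfloor$, $z_t=\lfloor (i_t+dr-n-1)/d\rfloor$ and $q_t=z_t-y_t-r+q$ (which lies in $\{0,1\}$). For $0\le x\le\lfloor r/2\rfloor$: if $y_s\le x$ (in particular if $s=0$), then $\mathrm{leap}_1(a,x)=q-x$; otherwise let $h\in\{1,\dots,s\}$ be the index with $y_{h-1}\le x<y_h$ and set $\mathrm{leap}_1(a,x)=\max\big(\{y_h-x+q_h\}\cup\{y_j-y_{j-1}+q_j: h<j\le s\}\cup\{q-y_s\}\big)$. *)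

(* Defs.v *)
From mathcomp Require Import all_boot all_order all_algebra.
Set Implicit Arguments. Unset Strict Implicit. Unset Printing Implicit Defensive.
Import Order.TTheory GRing.Theory Num.Theory.

(* Vertices of Q_n(d,r): pairs (a, x) with a in Z_2^n (a bit vector indexed by
   'I_n, 0-based: coordinate k corresponds to the paper's index k+1) and x in Z_r
   (represented by 'I_r, i.e. 0..r-1). *)
Definition vertex (n r : nat) := ({ffun 'I_n -> bool} * 'I_r)%type.

Definition flipc (n : nat) (a : {ffun 'I_n -> bool}) (k : nat) : {ffun 'I_n -> bool} :=
  [ffun i => a i (+) (val i == k)].

(* Adjacency of Q_n(d,r): (a,x) ~ (a + e_{i+dx}, x) for 1 <= i <= d (subscripts mod n,
   1-based; with j = i-1 the 0-based coordinate is (j + d x) mod n), and (a,x) ~ (a, x +- 1). *)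
Definition qadj (n d r : nat) : rel (vertex n r) :=
  fun u v =>
    ((u.2 == v.2) && [exists j : 'I_d, v.1 == flipc u.1 ((j + d * u.2) %% n)])
    || ((u.1 == v.1) && ((val v.2 == (val u.2).+1 %% r) || (val u.2 == (val v.2).+1 %% r))).

(* Graph distance: the least k such that there is a walk of length k from u to v
   (walks of length < #|T| suffice in a connected graph). *)
Definition walkb (T : finType) (e : rel T) (k : nat) (u v : T) : bool :=
  [exists s : k.-tuple T, path e u s && (last u s == v)].

Definition gdist (T : finType) (e : rel T) (u v : T) : nat :=
  find (fun k => walkb e k u v) (iota 0 #|T|).

Definition hweight (n : nat) (a : {ffun 'I_n -> bool}) : nat := #|[pred i | a i]|.

Definition ceil_div (n d : nat) : nat := (n + d.-1) %/ d.

(* leap_1(a, x) for the case dr >= 2n, following the paper literally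
   (1-based indices i_1 < ... < i_s of the ones of a). *)
Definition leap1 (n d r : nat) (a : {ffun 'I_n -> bool}) (x : nat) : int :=
  let q := ceil_div n d in
  let idx := [seq (val i).+1 | i <- enum 'I_n & a i] in
  let s := size idx in
  let ys := 0 :: [seq (i.-1) %/ d | i <- idx] in
  let y t := nth 0 ys t in
  let z t := (nth 0 idx t.-1 + d * r - n - 1) %/ d in
  let qt t : int := ((z t)%:Z - (y t)%:Z - r%:Z + q%:Z)%R in
  if y s <= x then (q%:Z - x%:Z)%R
  else
    let h := find (fun v => x < v) ys in
    foldr Num.max (q%:Z - (y s)%:Z)%R
      (((y h)%:Z - x%:Z + qt h)%R
         :: [seq ((y j)%:Z - (y j.-1)%:Z + qt j)%R | j <- iota h.+1 (s - h)]).

Arguments qadj : clear implicits.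
Arguments leap1 : clear implicits.

(* Main.v *)
(* Lift the ring coordinate of a walk to Z: if it ranges over [-m, M] and ends at p, then the
   walk has length at least |a| + 2m + 2M - |p|, and every one of a is flipped from [-m, M].
   For p = x this is attained by going back to -m, up to M, then back to x. Ordering the ones,
   an optimal arc serves the ones before some index forwards and the others backwards, and
   these choices are the terms of leap_1, so that leap_1 is the maximum of q - m - M.
   Lifts with p <> x have |p| >= r - x and lose against m = 0, M = max(x, q - 1),
   because 2(q - 1) <= r; so do arcs with m or M at least q - 1, which may wrap around. *)

Require Import Defs.
From mathcomp Require Import all_boot all_order all_algebra zify ring.
Import Order.TTheory GRing.Theory Num.Theory.
Set Implicit Arguments. Unset Strict Implicit. Unset Printing Implicit Defensive.

(** * Walks and graph distance *)

Lemma walkbP (T : finType) (e : rel T) k u v :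
  reflect (exists s : seq T, [/\ size s = k, path e u s & last u s = v])
          (walkb e k u v).
Proof.
apply: (iffP existsP) => [[s /andP[es /eqP ls]]|[s [sk es ls]]].
  by exists s; rewrite size_tuple.
have sz : size s == k by rewrite sk.
by exists (Tuple sz); rewrite /= es ls eqxx.
Qed.

Lemma walkb0 (T : finType) (e : rel T) u : walkb e 0 u u.
Proof. by apply/walkbP; exists [::]. Qed.

Lemma walkb_cat (T : finType) (e : rel T) j k u v w :
  walkb e j u v -> walkb e k v w -> walkb e (j + k) u w.
Proof.
move=> /walkbP[s [<- es <-]] /walkbP[t [<- et <-]].
by apply/walkbP; exists (s ++ t); rewrite size_cat cat_path es et last_cat.
Qed.

Lemma walkb_rcons (T : finType) (e : rel T) k u v w :
  walkb e k u v -> e v w -> walkb e k.+1 u w.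
Proof.
move=> uv vw; rewrite -addn1; apply: walkb_cat uv _.
by apply/walkbP; exists [:: w]; rewrite /= vw.
Qed.

(** Shortening to a simple path bounds the length by the number of distinct vertices. [gdist]
    searches only lengths below [#|T|], so minimality has to be tested there. *)
Lemma walkb_ltn_card (T : finType) (e : rel T) k u v :
  walkb e k u v -> exists2 j, j <= k & (j < #|T|) && walkb e j u v.
Proof.
move=> /walkbP[s [<- es <-]]; case/shortenP: es => p ep up sub_p.
exists (size p); first by apply: uniq_leq_size (sub_p); case/andP: up.
apply/andP; split; first by move/card_uniqP: up => /= <-; apply: max_card.
by apply/walkbP; exists p.
Qed.

Lemma gdist_eq (T : finType) (e : rel T) u v k :
  walkb e k u v -> (forall j, walkb e j u v -> k <= j) -> gdist e u v = k.
Proof.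
move=> walk_k min_k.
have lt_k : k < #|T|.
  have [j le_jk /andP[lt_j /min_k le_kj]] := walkb_ltn_card walk_k; lia.
have has_walk : has (fun i => walkb e i u v) (iota 0 #|T|).
  by apply/hasP; exists k; rewrite // mem_iota.
have lt_g : gdist e u v < #|T| by move: has_walk; rewrite has_find size_iota.
have := nth_find 0 has_walk; rewrite nth_iota // => /min_k le_kg.
apply/eqP; rewrite eqn_leq le_kg andbT leqNgt; apply/negP => lt_kg.
by have := before_find 0 lt_kg; rewrite nth_iota // add0n walk_k.
Qed.

(** * Hamming weight under bit flips *)

Lemma hweight0 n : hweight [ffun _ : 'I_n => false] = 0.
Proof. by apply: eq_card0 => i; rewrite !inE ffunE. Qed.

Lemma hweight_eq0 n (a : {ffun 'I_n -> bool}) :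
  hweight a = 0 -> a = [ffun _ => false].
Proof. by move=> /card0_eq a0; apply/ffunP => i; have := a0 i; rewrite ffunE inE. Qed.

Lemma hweight_flipc n (a : {ffun 'I_n -> bool}) (k : 'I_n) :
  a k -> hweight a = (hweight (flipc a k)).+1.
Proof.
move=> ak; rewrite /hweight (cardD1 k) inE ak add1n; congr _.+1.
apply: eq_card => i; rewrite !inE ffunE -val_eqE /=.
by have [/val_inj->|_] := eqVneq; rewrite ?ak ?addbF.
Qed.

Lemma flipcK n k : involutive (fun a : {ffun 'I_n -> bool} => flipc a k).
Proof. by move=> a; apply/ffunP => i; rewrite !ffunE addbK. Qed.

Lemma hweight_flipc_le n (a : {ffun 'I_n -> bool}) k :
  hweight (flipc a k) <= (hweight a).+1.
Proof.
rewrite leqNgt; apply/negP => lt_w.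
have [lt_kn | le_nk] := ltnP k n; last first.
  suff fa : flipc a k = a by rewrite fa in lt_w; lia.
  apply/ffunP => i; rewrite ffunE; have := ltn_ord i.
  by have [->|] := eqVneq (val i) k; rewrite ?addbF // ltnNge le_nk.
have := @hweight_flipc n (flipc a k) (Ordinal lt_kn).
have := @hweight_flipc n a (Ordinal lt_kn).
rewrite flipcK /= ffunE eqxx /=; case: (a _) => /=; last by move=> _ /(_ isT); lia.
by move=> /(_ isT); lia.
Qed.

(** * Lower bound: walks lifted to the integers *)

(* Coordinate [k] can be flipped from a ring position in [[-m, M]], positions being lifted to Z. *)
Definition covers (n d : nat) (m M : nat) (k : nat) : Prop :=
  exists (p c : int) (j : nat),
    [/\ (- m%:Z <= p <= M%:Z)%R, j < d & (k%:Z = d%:Z * p + j%:Z + c * n%:Z)%R].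

Lemma covers_le n d m M m' M' k :
  m <= m' -> M <= M' -> covers n d m M k -> covers n d m' M' k.
Proof. by move=> ? ? [p [c [j [? ? ?]]]]; exists p, c, j; split=> //; lia. Qed.

(* The cost [2 m + 2 M - |p|] of a lifted walk ending at [p] with range [[-m, M]]
   grows by at most 1 with each step. *)
Definition lifted_bound n d r (v : vertex n r) (k : nat) : Prop :=
  exists (p t : int) (m M : nat),
    [/\ (p = v.2%:Z + t * r%:Z)%R, (- m%:Z <= p <= M%:Z)%R,
        (forall i : 'I_n, v.1 i -> covers n d m M i)
      & ((hweight v.1)%:Z + 2 * m%:Z + 2 * M%:Z - `|p| <= k%:Z)%R].

(** As [n] divides [d * r], a full turn of the ring moves the flipped coordinate by a multiple of
    [n], which [c] absorbs. *)
Lemma modn_add_covers n d r x p t j : 0 < n -> n %| d * r -> j < d ->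
  (p = x%:Z + t * r%:Z)%R ->
  exists c : int, (((j + d * x) %% n)%:Z = d%:Z * p + j%:Z + c * n%:Z)%R.
Proof.
move=> n_gt0 /dvdnP[c drE] lt_jd ->.
exists (- ((j + d * x) %/ n)%:Z - t * c%:Z)%R.
have /(congr1 Posz) := divn_eq (j + d * x) n.
rewrite !PoszD !PoszM; move: (_ %/ _) (_ %% _) => f e E.
have E' : (d%:Z * r%:Z = c%:Z * n%:Z)%R by rewrite -!PoszM drE.
have -> : (e%:Z = j%:Z + d%:Z * x%:Z - f%:Z * n%:Z)%R by rewrite E addrC addKr.
rewrite mulrDr (mulrCA d%:Z%R) E'; ring.
Qed.

Lemma succ_mod_lift r x y (p t : int) : x < r -> y = x.+1 %% r ->
  (p = x%:Z + t * r%:Z)%R -> exists t' : int, (p + 1 = y%:Z + t' * r%:Z)%R.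
Proof.
move=> lt_x -> ->; have [xr|xr] := eqVneq x.+1 r.
  exists (t + 1)%R; rewrite xr modnn mulrDl mul1r add0r -{2}xr; lia.
exists t; rewrite modn_small; lia.
Qed.

Lemma pred_mod_lift r x y (p t : int) : y < r -> x = y.+1 %% r ->
  (p = x%:Z + t * r%:Z)%R -> exists t' : int, (p - 1 = y%:Z + t' * r%:Z)%R.
Proof.
move=> lt_y -> ->; have [yr|yr] := eqVneq y.+1 r.
  exists (t - 1)%R; rewrite yr modnn mulrBl mul1r add0r -{2}yr; lia.
exists t; rewrite modn_small; lia.
Qed.

(** A step inside the range changes only [|p|], by 1. A step leaving it adds 2 for the wider range,
    but [|p|] also grows by 1. *)
Lemma step_cost_le (p p' : int) m M :
  (- m%:Z <= p <= M%:Z -> (p' == p + 1) || (p' == p - 1) ->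
   exists m' M' : nat, [/\ (m <= m')%N, (M <= M')%N, - m'%:Z <= p' <= M'%:Z
     & 2 * m'%:Z + 2 * M'%:Z - `|p'| <= 2 * m%:Z + 2 * M%:Z - `|p| + 1])%R.
Proof.
move=> rng step; exists (maxn m `|Num.min p' 0|%N), (maxn M `|Num.max p' 0|%N).
by split; lia.
Qed.

Lemma lifted_bound_step n d r (u v : vertex n r) k : 0 < n -> n %| d * r ->
  qadj n d r u v -> lifted_bound d u k -> lifted_bound d v k.+1.
Proof.
move=> n_gt0 dvd_n.
case: u v => [a x] [b y] adj [p [t [m [M [/= pE p_rng cov le_k]]]]].
case/orP: adj => /andP[/eqP /= <- step].
  have {step} [j /eqP ->] := existsP step.
  exists p, t, m, M; split=> //=; last first.
    move: (hweight_flipc_le a ((j + d * x) %% n)) le_k.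
    by move: (hweight (flipc _ _)) (hweight a) => w' w; clear; lia.
  move=> i; rewrite ffunE; have [iE _|_] := eqVneq; last by rewrite addbF; apply: cov.
  have [c E] := modn_add_covers n_gt0 dvd_n (ltn_ord j) pE.
  by exists p, c, j; rewrite iE.
have [p' [step' [t' p'E]]] : exists p' : int,
    ((p' == p + 1) || (p' == p - 1))%R /\ exists t' : int, (p' = y%:Z + t' * r%:Z)%R.
  case/orP: step => /eqP /= E.
  - by exists (p + 1)%R; rewrite eqxx; split=> //; apply: succ_mod_lift E pE.
  - by exists (p - 1)%R; rewrite eqxx orbT; split=> //; apply: pred_mod_lift E pE.
have [m' [M' [le_m le_M p'_rng le_cost]]] := step_cost_le p_rng step'.
exists p', t', m', M'; split=> //=; first by move=> i /cov; apply: covers_le.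
move: le_cost le_k; move: (hweight a) => w; clear; lia.
Qed.

Lemma lifted_bound_walk n d r (n_gt0 : 0 < n) (r_gt0 : 0 < r) (v : vertex n r) k :
  n %| d * r ->
  walkb (qadj n d r) k ([ffun _ => false], Ordinal r_gt0) v -> lifted_bound d v k.
Proof.
move=> dvd_n /walkbP[s [<- es <-]] {v k}; elim/last_ind: s es => [_|s v IH].
  exists 0%R, 0%R, 0, 0; split=> //=; last by rewrite hweight0.
  by move=> i; rewrite ffunE.
rewrite rcons_path last_rcons size_rcons => /andP[/IH bnd /lifted_bound_step]; exact.
Qed.

(** * Upper bound: walks along arcs *)

Definition ring_pos r (r_gt0 : 0 < r) N : 'I_r := Ordinal (ltn_pmod N r_gt0).

Lemma succ_modn N r : (N %% r).+1 %% r = N.+1 %% r.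
Proof. by rewrite -addn1 modnDml addn1. Qed.

(** The walk is built from its end, by induction on its length: the last edge flips a one available
    at the top position [N + L], or climbs to it if there is none. *)
Lemma walkb_up n d r (r_gt0 : 0 < r) (a : {ffun 'I_n -> bool}) N L :
  n %| d * r ->
  (forall i : 'I_n, a i -> exists P j,
     [/\ N <= P <= N + L, j < d & val i = (j + d * P) %% n]) ->
  walkb (qadj n d r) (L + hweight a)
    ([ffun _ => false], ring_pos r_gt0 N) (a, ring_pos r_gt0 (N + L)).
Proof.
move=> dvd_n; have [b] := ubnP (L + hweight a).
elim: b a L => // b IH a L lt_b cov.
have [/existsP[k /andP[ak /existsP[j /eqP kE]]] | no_flip] :=
    boolP [exists k : 'I_n, a k && [exists j : 'I_d, val k == (j + d * (N + L)) %% n]].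
  have wE := hweight_flipc ak.
  have {IH} walk : walkb (qadj n d r) (L + hweight (flipc a k))
     ([ffun _ => false], ring_pos r_gt0 N) (flipc a k, ring_pos r_gt0 (N + L)).
    apply: IH => [|i]; first by lia.
    by rewrite ffunE; have [/val_inj->|_] := eqVneq (val i) k; rewrite ?ak ?addbF //; apply: cov.
  rewrite wE addnS; apply: walkb_rcons walk _.
  apply/orP; left; rewrite eqxx; apply/existsP; exists j; apply/eqP => /=.
  suff <- : val k = (j + d * ((N + L) %% r)) %% n by rewrite flipcK.
  (* Full turns contribute a multiple of [d * r], hence of [n]. *)
  rewrite kE {1}(divn_eq (N + L) r) mulnDr addnCA mulnCA -modnDml.
  by rewrite (eqP (dvdn_mull _ dvd_n)) add0n.
have not_at (i : 'I_n) j : a i -> j < d -> val i <> (j + d * (N + L)) %% n.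
  move=> ai lt_jd iE; case/negP: no_flip; apply/existsP; exists i; rewrite ai.
  by apply/existsP; exists (Ordinal lt_jd); apply/eqP.
clear no_flip; case: L => [|L] in lt_b cov not_at *.
  rewrite addn0; suff /hweight_eq0 -> : hweight a = 0 by rewrite hweight0 addn0; apply: walkb0.
  apply: eq_card0 => i; rewrite !inE; apply/negP => ai.
  have [P [j [P_rng lt_jd iE]]] := cov i ai.
  by apply: (not_at i j) => //; rewrite iE; congr ((_ + _ * _) %% _); lia.
rewrite addSn; apply: (walkb_rcons (v := (a, ring_pos r_gt0 (N + L)))).
  apply: IH => [|i ai]; first by lia.
  have [P [j [P_rng lt_jd iE]]] := cov i ai; exists P, j; split=> //.
  have [PE|] := eqVneq P (N + L.+1); last by lia.
  by case: (not_at i j) => //; rewrite -PE.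
by apply/orP; right; rewrite eqxx /= addnS !succ_modn eqxx.
Qed.

Lemma walkb_down n d r (r_gt0 : 0 < r) (a : {ffun 'I_n -> bool}) N L :
  walkb (qadj n d r) L (a, ring_pos r_gt0 (N + L)) (a, ring_pos r_gt0 N).
Proof.
elim: L => [|L IH]; first by rewrite addn0; apply: walkb0.
rewrite -add1n; apply: walkb_cat IH; apply: walkb_rcons (walkb0 _ _) _.
by apply/orP; right; rewrite eqxx /= addnS !succ_modn eqxx orbT.
Qed.

(* The form that [covers] takes on short arcs: [k] is flippable from [[0, M]] or from [[-m, -1]]. *)
Definition arc_covers n d m M k := (k %/ d <= M) || (n <= k + d * m).

(** Down from 0 to [-m], up to [M] with all flips on the way, then down to [x]. *)
Lemma walkb_arc n d r (r_gt0 : 0 < r) (a : {ffun 'I_n -> bool}) (x : 'I_r) m M :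
  0 < d -> n %| d * r -> n <= d * r -> m <= r -> x <= M ->
  (forall i : 'I_n, a i -> arc_covers n d m M i) ->
  walkb (qadj n d r) (m + (m + M + hweight a) + (M - x))
    ([ffun _ => false], Ordinal r_gt0) (a, x).
Proof.
move=> d_gt0 dvd_n le_n le_mr le_xM cov.
(* All positions are shifted by [r], so that [-m] becomes the natural number [r - m]. *)
have -> : Ordinal r_gt0 = ring_pos r_gt0 ((r - m) + m).
  by apply: val_inj; rewrite /= subnK // modnn.
have -> : x = ring_pos r_gt0 (r + x).
  by apply: val_inj; rewrite /= modnDl modn_small.
have -> : val (ring_pos r_gt0 (r + x)) = x by rewrite /= modnDl modn_small.
apply: walkb_cat; first apply: walkb_cat (walkb_down _ _ _ _ _) _; last first.
  by apply: (walkb_down _ _ _ (r + x) (M - x)).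
have <- : (r - m) + (m + M) = r + x + (M - x) by lia.
apply: walkb_up => // i /cov; case: i => k lt_kn /= {cov}.
case/orP=> [le_kM | le_nk].
  exists (r + k %/ d), (k %% d); rewrite ltn_mod; split=> //; first by move: (k %/ d) le_kM => e; lia.
  rewrite mulnDr addnCA -modnDml (eqP dvd_n) add0n.
  by rewrite addnC mulnC -divn_eq modn_small.
(* Modulo [n], [k + d * r - n] is [k], and its quotient by [d] is a position at or below the shifted
   origin [r]. *)
exists ((k + d * r - n) %/ d), ((k + d * r - n) %% d); rewrite ltn_mod; split=> //; last first.
  rewrite addnC mulnC -divn_eq -[RHS](modnDr _ n) subnK; last by lia.
  by rewrite addnC -modnDml (eqP dvd_n) add0n modn_small.
apply/andP; split.
  by rewrite leq_divRL // mulnC mulnBr; lia.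
by rewrite -ltnS ltn_divLR // mulnC; nia.
Qed.

(** * List maxima, and the ones of [a] with their ring positions *)

Lemma foldr_max_mem (c : int) l : foldr Num.max c l \in c :: l.
Proof.
elim: l => [|v l IH] /=; first exact: mem_head.
rewrite maxEle; case: ifP => _; last by rewrite !inE eqxx orbT.
by move: IH; rewrite !inE => /orP[->|->]; rewrite ?orbT.
Qed.

Lemma foldr_max_ge (c : int) l v : v \in c :: l -> (v <= foldr Num.max c l)%R.
Proof.
elim: l => [|w l IH] /=; first by rewrite inE => /eqP->.
by rewrite !inE le_max => /or3P[vc|/eqP->|vl]; rewrite ?lexx // IH ?orbT // inE ?vc ?vl ?orbT.
Qed.

Definition ones n (a : {ffun 'I_n -> bool}) : seq nat :=
  [seq (val i).+1 | i <- enum 'I_n & a i].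

Lemma ones_sorted n (a : {ffun 'I_n -> bool}) : sorted ltn (ones a).
Proof.
rewrite /ones (map_comp succn) sorted_map; apply: (subseq_sorted ltn_trans).
  exact: (map_subseq val (filter_subseq a (enum 'I_n))).
by rewrite val_enum_ord iota_ltn_sorted.
Qed.

Lemma mem_ones n (a : {ffun 'I_n -> bool}) (i : 'I_n) : a i -> i.+1 \in ones a.
Proof. by move=> ai; apply: map_f; rewrite mem_filter ai mem_enum. Qed.

Lemma onesP n (a : {ffun 'I_n -> bool}) k :
  k \in ones a -> exists2 i : 'I_n, a i & k = i.+1.
Proof. by case/mapP => i; rewrite mem_filter => /andP[ai _] ->; exists i. Qed.

(** With this quotient called [z], [r - z] is the least backward reach [m] such that
    [n <= k + d * m]: the next lemma shows that it suffices, the one after that it is minimal. *)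
Lemma backward_pos_le n d r k : 0 < d -> k < n -> n <= d * r ->
  (k + d * r - n) %/ d <= r.
Proof. by move=> d0 lt_k le_n; rewrite -ltnS ltn_divLR // mulSn mulnC; lia. Qed.

Lemma backward_pos_covers n d r k : 0 < d -> n <= d * r ->
  n <= k + d * (r - (k + d * r - n) %/ d).
Proof.
move=> d0 le_n; rewrite mulnBr; have := leq_divM (k + d * r - n) d.
by rewrite (mulnC _ d); move: (d * (_ %/ _)) => e; lia.
Qed.

Lemma backward_pos_ge n d r k m : 0 < d -> n <= k + d * m ->
  r - m <= (k + d * r - n) %/ d.
Proof. by move=> d0 le_n; rewrite leq_divRL // mulnC mulnBr; lia. Qed.

(* The paper's [y_t] and [z_t]: the first ring positions, going forwards resp. backwards
   from 0, at which the [t]-th one can be flipped; [t] starts at 1 and [y_0 = 0]. *)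
Definition fwd n d (a : {ffun 'I_n -> bool}) t := nth 0 (0 :: [seq i.-1 %/ d | i <- ones a]) t.
Definition bwd n d r (a : {ffun 'I_n -> bool}) t := (nth 0 (ones a) t.-1 + d * r - n - 1) %/ d.

Lemma leap1E n d r (a : {ffun 'I_n -> bool}) x :
  let q := (ceil_div n d)%:Z%R in
  let s := size (ones a) in
  let y := fwd d a in
  let qt t := ((bwd d r a t)%:Z - (y t)%:Z - r%:Z + q)%R in
  let h := find (fun v => x < v) (0 :: [seq i.-1 %/ d | i <- ones a]) in
  leap1 n d r a x =
  if y s <= x then (q - x%:Z)%R else
  foldr Num.max (q - (y s)%:Z)%R
   (((y h)%:Z - x%:Z + qt h)%R
     :: [seq ((y j)%:Z - (y j.-1)%:Z + qt j)%R | j <- iota h.+1 (s - h)]).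
Proof. by []. Qed.

(** Index shift: [fwd] counts the ones from 1, [nth] from 0. *)
Lemma fwdS n d (a : {ffun 'I_n -> bool}) t : t < size (ones a) ->
  exists i : 'I_n, [/\ a i, nth 0 (ones a) t = i.+1 & fwd d a t.+1 = i %/ d].
Proof.
move=> lt_t; have [i ai iE] := onesP (mem_nth 0 lt_t).
by exists i; rewrite /fwd /= (nth_map 0) // iE.
Qed.

Lemma bwdS n d r (a : {ffun 'I_n -> bool}) t (i : 'I_n) :
  nth 0 (ones a) t = i.+1 -> bwd d r a t.+1 = (i + d * r - n) %/ d.
Proof. by rewrite /bwd /= => ->; congr (_ %/ _); lia. Qed.

Lemma nth_ones_le n (a : {ffun 'I_n -> bool}) t u :
  t <= u -> u < size (ones a) -> nth 0 (ones a) t <= nth 0 (ones a) u.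
Proof.
move=> le_tu lt_u; have srt : sorted leq (ones a).
  by apply: sub_sorted (ones_sorted a) => i j; apply: ltnW.
by apply: (sorted_leq_nth leq_trans leqnn 0 srt); rewrite ?inE //; lia.
Qed.

Lemma nth_ones n (a : {ffun 'I_n -> bool}) (i : 'I_n) : a i ->
  exists2 t, t < size (ones a) & nth 0 (ones a) t = i.+1.
Proof.
by move/mem_ones => ai; exists (index i.+1 (ones a)); rewrite ?index_mem ?nth_index.
Qed.

Lemma fwd_le n d (a : {ffun 'I_n -> bool}) t u :
  t <= u -> u <= size (ones a) -> fwd d a t <= fwd d a u.
Proof.
case: t => [|t] // ; case: u => [|u] // le_tu lt_u.
have [i [_ iE ->]] := fwdS d (leq_trans le_tu lt_u).
have [j [_ jE ->]] := fwdS d lt_u.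
by apply: leq_div2r; rewrite -ltnS -iE -jE nth_ones_le.
Qed.

(** * [leap1] as an optimum over arcs *)

(** By monotonicity, the ones before index [t] are reached forwards by [fwd d a t], and the later
    ones need no more backward reach than the one at [t]. *)
Lemma split_covers n d r (a : {ffun 'I_n -> bool}) M t :
  0 < d -> n <= d * r -> t < size (ones a) -> fwd d a t <= M ->
  forall i : 'I_n, a i -> arc_covers n d (r - bwd d r a t.+1) M i.
Proof.
move=> d_gt0 le_n lt_t le_M i /nth_ones[u lt_u uE]; apply/orP.
have [lt_ut | le_tu] := ltnP u t.
  left; have [j [_]] := fwdS d lt_u; rewrite uE => -[/val_inj <-] <-.
  exact: leq_trans (fwd_le _ lt_ut (ltnW lt_t)) le_M.
right; have [j [_ jE _]] := fwdS d lt_t; rewrite (bwdS _ _ jE).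
have := backward_pos_covers j d_gt0 le_n.
by have := nth_ones_le le_tu lt_u; rewrite jE uE; lia.
Qed.

Lemma bwd_le n d r (a : {ffun 'I_n -> bool}) t : 0 < d -> n <= d * r ->
  t < size (ones a) -> bwd d r a t.+1 <= r.
Proof.
move=> d_gt0 le_n lt_t; have [j [_ jE _]] := fwdS d lt_t.
by rewrite (bwdS _ _ jE) backward_pos_le.
Qed.

(** The index found is a successor because [fwd d a 0 = 0] never exceeds [x]. *)
Lemma first_fwd_gt n d (a : {ffun 'I_n -> bool}) x : x < fwd d a (size (ones a)) ->
  exists k, [/\ find (fun v => x < v) (0 :: [seq i.-1 %/ d | i <- ones a]) = k.+1,
    k < size (ones a), x < fwd d a k.+1 & forall t, t <= k -> fwd d a t <= x].
Proof.
move=> lt_xs; set s := size _; set h := find _ _.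
have has_gt : has (fun v => x < v) (0 :: [seq i.-1 %/ d | i <- ones a]).
  by apply/hasP; exists (fwd d a s) => //; apply: mem_nth; rewrite /= size_map.
have lt_xh : x < fwd d a h by apply: (nth_find 0 has_gt).
have before t : t < h -> fwd d a t <= x.
  by move=> lt_th; rewrite leqNgt; apply/negbT/(before_find 0 lt_th).
have lt_hs : h < s.+1 by move: has_gt; rewrite has_find /= size_map.
by case: (h) lt_xh lt_hs before => // k lt_xk lt_ks before; exists k.
Qed.

(** In each term [y_t] cancels against [q_t]. The arcs [(m, M)] are [(0, y_s)] for the last term,
    [(r - z_h, x)] for index [h], and [(r - z_j, y_{j-1})] for [j > h]. *)
Lemma leap1_attained n d r (a : {ffun 'I_n -> bool}) x : 0 < d -> n <= d * r ->
  exists m M, [/\ m <= r, x <= M,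
     leap1 n d r a x = ((ceil_div n d)%:Z - m%:Z - M%:Z)%R
   & forall i : 'I_n, a i -> arc_covers n d m M i].
Proof.
move=> d_gt0 le_n; rewrite leap1E; cbv zeta.
set s := size _; set h := find _ _; set q := ceil_div n d.
have cov_s M : fwd d a s <= M -> forall i : 'I_n, a i -> arc_covers n d 0 M i.
  move=> le_M i /nth_ones[u lt_u uE]; apply/orP; left.
  have [j [_]] := fwdS d lt_u; rewrite uE => -[/val_inj <-] <-.
  exact: leq_trans (fwd_le _ lt_u (leqnn s)) le_M.
case: ifP => [le_sx | /negbT]; first by exists 0, x; split=> //; [lia | apply: cov_s].
rewrite -ltnNge => lt_xs.
have [k [hE lt_ks lt_xh le_hx]] := first_fwd_gt lt_xs.
rewrite /h hE => {h hE}.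
have := foldr_max_mem (q%:Z - (fwd d a s)%:Z)%R
  (((fwd d a k.+1)%:Z - x%:Z + ((bwd d r a k.+1)%:Z - (fwd d a k.+1)%:Z - r%:Z + q%:Z))%R
   :: [seq ((fwd d a j)%:Z - (fwd d a j.-1)%:Z
       + ((bwd d r a j)%:Z - (fwd d a j)%:Z - r%:Z + q%:Z))%R | j <- iota k.+2 (s - k.+1)]).
rewrite inE => /predU1P[->|]; first by exists 0, (fwd d a s); split=> //; [lia|lia|apply: cov_s].
rewrite inE => /predU1P[->|/mapP[j]].
  exists (r - bwd d r a k.+1), x; split=> //; first exact: leq_subr.
    by have := bwd_le d_gt0 le_n lt_ks; lia.
  by apply: split_covers => //; apply: le_hx.
rewrite mem_iota => j_rng ->; case: j j_rng => // j j_rng.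
have lt_js : j < s by lia.
exists (r - bwd d r a j.+1), (fwd d a j); split=> //; first exact: leq_subr.
- by apply: leq_trans (ltnW lt_xh) (fwd_le _ _ _); [lia | exact: ltnW].
- by have := bwd_le d_gt0 le_n lt_js; rewrite /=; lia.
exact: split_covers.
Qed.

(** If [M] falls short of [y_s], the first one beyond [M] must be served backwards, which bounds [m]
    below; the term of that one then dominates. *)
Lemma leap1_max n d r (a : {ffun 'I_n -> bool}) x m M : 0 < d -> x <= M ->
  (forall i : 'I_n, a i -> arc_covers n d m M i) ->
  ((ceil_div n d)%:Z - m%:Z - M%:Z <= leap1 n d r a x)%R.
Proof.
move=> d_gt0 le_xM cov; rewrite leap1E; cbv zeta.
set s := size _; set h := find _ _; set q := ceil_div n d.
case: ifP => [le_sx | /negbT]; first by lia.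
rewrite -ltnNge => lt_xs.
have [lt_Ms | le_sM] := ltnP M (fwd d a s); last first.
  apply: (@le_trans _ _ (q%:Z - (fwd d a s)%:Z)%R); first by lia.
  by apply: foldr_max_ge; rewrite mem_head.
have [k [hE lt_ks _ le_hx]] := first_fwd_gt lt_xs.
have [j [_ lt_js lt_Mj le_jM]] := first_fwd_gt lt_Ms.
rewrite /h hE => {h hE}.
have le_kj : k <= j.
  by rewrite leqNgt; apply/negP => /le_hx; lia.
have le_m : r - m <= bwd d r a j.+1.
  have [i [ai iE yE]] := fwdS d lt_js; rewrite (bwdS _ _ iE).
  apply: backward_pos_ge d_gt0 _.
  by have := cov i ai; rewrite /arc_covers -yE leqNgt lt_Mj.
(* If the first one beyond [M] is also the first beyond [x], the bound [x <= M] gives the term of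
   [h]; otherwise [y_j <= M] gives a later term. *)
have [jk | ne_jk] := eqVneq j k.
  rewrite jk in le_m.
  apply: (@le_trans _ _ (q%:Z - x%:Z - (r%:Z - (bwd d r a k.+1)%:Z))%R); first by lia.
  by apply: foldr_max_ge; rewrite !inE; apply/or3P/Or32/eqP; lia.
have := le_jM j (leqnn j) => le_yM.
apply: (@le_trans _ _ (q%:Z - (fwd d a j)%:Z - (r%:Z - (bwd d r a j.+1)%:Z))%R); first by lia.
apply: foldr_max_ge; rewrite !inE; apply/or3P/Or33/mapP; exists j.+1.
  by rewrite mem_iota; lia.
by rewrite /=; lia.
Qed.

(** * From lifted ranges to short arcs *)

Lemma ceil_div_bounds n d : 0 < d -> 0 < n ->
  [/\ 0 < ceil_div n d, n <= d * ceil_div n d & d * (ceil_div n d).-1 < n].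
Proof.
move=> d_gt0 n_gt0; rewrite /ceil_div.
have := divn_eq (n + d.-1) d; have := ltn_pmod (n + d.-1) d_gt0.
move: (_ %/ _) (_ %% _) => [|q] e lt_e; rewrite /= ?mulSn ?mulnS 1?(mulnC q) => E; split; lia.
Qed.

(** Both [d * (m + 1)] and [d * (M + 1)] are below [n], so [d * p + j] lies strictly between [-n]
    and [n]: [c] is 0 for [p >= 0] and 1 for [p < 0]. *)
Lemma arc_covers_lift n d m M (k : nat) : 0 < n -> 0 < d -> k < n ->
  m.+1 < ceil_div n d -> M.+1 < ceil_div n d ->
  covers n d m M k -> arc_covers n d m M k.
Proof.
move=> n_gt0 d_gt0 lt_kn lt_m lt_M [p [c [j [p_rng lt_jd kE]]]].
have [_ _ lt_q] := ceil_div_bounds d_gt0 n_gt0.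
have le_dm : d * m.+1 < n by apply: leq_ltn_trans lt_q; rewrite leq_mul2l; lia.
have le_dM : d * M.+1 < n by apply: leq_ltn_trans lt_q; rewrite leq_mul2l; lia.
rewrite /arc_covers -ltnS ltn_divLR // (mulnC M.+1).
have [p_ge0 | p_lt0] := boolP (0 <= p)%R.
  case: p p_ge0 p_rng kE => // p _ p_rng kE.
  have le_dp : d * p <= d * M by rewrite leq_mul2l; lia.
  have c0 : c = 0%R by nia.
  by apply/orP; left; rewrite mulnS; lia.
have [p' pE] : exists p' : nat, p = (- p'.+1%:Z)%R by exists `|p|.-1; lia.
have le_dp : d * p'.+1 <= d * m by rewrite leq_mul2l; lia.
have c1 : c = 1%R by nia.
by apply/orP; right; nia.
Qed.

Lemma ring_lift_ge r (x : nat) (p t : int) : x <= r./2 -> x < r ->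
  (p = x%:Z + t * r%:Z -> p <> x%:Z -> (r - x)%N%:Z <= `|p|)%R.
Proof.
move=> le_x lt_x pE ne_p.
have [t0|[t1|t2]] : (t = 0 \/ 1 <= t \/ t <= - 1)%R by lia.
- by rewrite t0 in pE; lia.
- by have := ler_wpM2r (isT : (0 <= r%:Z)%R) t1; lia.
- by have := ler_wpM2r (isT : (0 <= r%:Z)%R) t2; lia.
Qed.

(** * The distance formula *)

Theorem mainTheorem8 (n d r : nat) (hn : 2 <= n) (hd : 1 <= d) (hr : 3 <= r)
  (hnd : d <= n) (hdiv : n %| d * r) (h2n : 2 * n <= d * r)
  (a : {ffun 'I_n -> bool}) (x : 'I_r) (hx : val x <= r./2) :
  ((gdist (qadj n d r) ([ffun _ => false], Ordinal (leq_trans (isT : (0 < 3)%N) hr)) (a, x))%:Z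
   = (hweight a)%:Z + 2%:Z * (ceil_div n d)%:Z - (val x)%:Z - 2%:Z * leap1 n d r a (val x))%R.
Proof.
have n_gt0 : 0 < n by lia.
have le_n : n <= d * r by lia.
have [m [M [le_mr le_xM leapE cov]]] := leap1_attained a x hd le_n.
have [q_gt0 le_nq lt_q] := ceil_div_bounds hd n_gt0.
rewrite leapE.
suff -> : gdist (qadj n d r) ([ffun _ => false], Ordinal (leq_trans (isT : 0 < 3) hr)) (a, x)
    = m + (m + M + hweight a) + (M - x).
  by rewrite /=; move: (nat_of_ord x) (ceil_div n d) (hweight a) le_xM => y q w; clear; lia.
apply: gdist_eq; first exact: walkb_arc.
move=> k /(lifted_bound_walk n_gt0 hdiv)[p [t [m' [M' [/= pE p_rng cov' le_k]]]]].
have best m1 M1 : x <= M1 -> (forall i : 'I_n, a i -> arc_covers n d m1 M1 i) ->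
    m + M <= m1 + M1.
  by move=> le_x1 /(leap1_max r hd le_x1); rewrite leapE; lia.
(* The forward arc up to position [q - 1] already covers all [n] coordinates. *)
have le_all : m + M <= maxn x (ceil_div n d).-1.
  apply: (best 0); first by exact: leq_maxl.
  move=> i _; apply/orP; left; apply: leq_trans (leq_maxr _ _).
  rewrite -ltnS prednK // ltn_divLR // mulnC.
  exact: leq_trans (ltn_ord i) le_nq.
have le_qr : 2 * (ceil_div n d).-1 <= r.
  by rewrite -(leq_pmul2l hd) mulnCA; lia.
have lt_xr := ltn_ord x; have {}hx : nat_of_ord x <= r./2 by [].
have [px | /eqP ne_px] := eqVneq p x%:Z%R; last first.
  (* The cost is at least the weight plus [|p| >= r - x], while [2 * (m + M) <= r] by [le_all]. *)
  by have := ring_lift_ge hx lt_xr pE ne_px; move: (hweight a) le_k => w le_k; lia.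
have [/andP[lt_m' lt_M'] | far] :=
  boolP ((m'.+1 < ceil_div n d) && (M'.+1 < ceil_div n d)).
  have {cov'} cov' (i : 'I_n) : a i -> arc_covers n d m' M' i.
    by move/cov'; apply: arc_covers_lift.
  have le_xM' : x <= M' by lia.
  have := best m' M' le_xM' cov'.
  by move: (hweight a) le_k => w le_k; lia.
(* Here [m' + M'] is at least [q - 1] and at least [x], so [le_all] suffices. *)
by move: (hweight a) le_k => w le_k; lia.
Qed.
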